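(* Let $d\ge1$ be an integer. There is a constant $c$, independent of $n$, such that for all integers $n\ge2$ $$\|\mathcal{L}_n\|\le c(\log n)^d\qquad\text{and}\qquad\|\mathcal{L}_n^*\|\le c(\log n)^d,$$ where $\|\cdot\|$ denotes the operator norm from $C(\triangle_H)$ to $C(\triangle_H)$ (with the uniform norm).
   Context: Let $\mathbb{R}_H^{d+1}=\{\mathbf t\in\mathbb{R}^{d+1}:t_1+\cdots+t_{d+1}=0\}$ and $\triangle_H=\{\mathbf t\in\mathbb{R}_H^{d+1}:0\le t_i-t_j\le1,\ 1\le i<j\le d+1\}$. Let $\mathbb{H}=\{\mathbf k\in\mathbb{Z}^{d+1}:k_1+\cdots+k_{d+1}=0,\ k_1\equiv\cdots\equiv k_{d+1}\ (\mathrm{mod}\ d+1)\}$ and $\phi_{\mathbf k}(\mathbf t)=e^{\frac{2\pi i}{d+1}\mathbf k\cdot\mathbf t}$. The group $\mathcal{G}=S_{d+1}$ acts by permuting coordinates, $\mathbf t\mapsto\mathbf t\sigma$, and $\rho(\sigma)$ is the sign of $\sigma$. The generalized cosine and sine functions are $$\mathsf{TC}_{\mathbf k}(\mathbf t)=\frac1{(d+1)!}\sum_{\sigma\in\mathcal{G}}\phi_{\mathbf k}(\mathbf t\sigma),\qquad \mathsf{TS}_{\mathbf k}(\mathbf t)=\frac1{(d+1)!}\sum_{\sigma\in\mathcal{G}}\rho(\sigma)\phi_{\mathbf k}(\mathbf t\sigma).$$ Let $\Lambda_n=\{\mathbf k\in\mathbb{H}:k_{d+1}\le k_d\le\cdots\le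 k_1\le k_{d+1}+(d+1)n\}$ and $\Lambda_n^\circ=\{\mathbf k\in\mathbb{H}:k_{d+1}<k_d<\cdots<k_1<k_{d+1}+(d+1)n\}$. For $\mathbf j\in\Lambda_n$ write $\mathbf j=(\{j_1\}^{p_1},\dots,\{j_\ell\}^{p_\ell})$ with distinct values $j_1>\cdots>j_\ell$ repeated $p_1,\dots,p_\ell\ge1$ times, and set $\lambda_{\mathbf j}^{(n)}=\frac{(d+1)!}{p_1!\,p_2!\cdots p_\ell!}$ if $j_1<j_\ell+(d+1)n$ and $\lambda_{\mathbf j}^{(n)}=\frac{(d+1)!}{(p_1+p_\ell)!\,p_2!\cdots p_{\ell-1}!}$ if $j_1=j_\ell+(d+1)n$. For $f\in C(\triangle_H)$ the interpolation operators are $$\mathcal{L}_nf(\mathbf t)=\sum_{\mathbf j\in\Lambda_n^\circ}f\big(\tfrac{\mathbf j}{(d+1)n}\big)\frac{d!\,(d+1)!}{n^d}\sum_{\mathbf k\in\Lambda_n^\circ}\mathsf{TS}_{\mathbf k}(\mathbf t)\overline{\mathsf{TS}_{\mathbf k}\big(\tfrac{\mathbf j}{(d+1)n}\big)},$$ $$\mathcal{L}_n^*f(\mathbf t)=\sum_{\mathbf j\in\Lambda_n}f\big(\tfrac{\mathbf j}{(d+1)n}\big)\frac{\lambda_{\mathbf j}^{(n)}}{(d+1)n^d}\sum_{\mathbf k\in\Lambda_n}\lambda_{\mathbf k}^{(n)}\mathsf{TC}_{\mathbf k}(\mathbf t)\overline{\mathsf{TC}_{\mathbf k}\big(\tfrac{\mathbf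 j}{(d+1)n}\big)}.$$ *)

(* Defs.v *)
From HB Require Import structures.
From mathcomp Require Import all_boot all_order all_algebra perm.
From mathcomp Require Import all_classical all_reals all_analysis.
From mathcomp Require Import complex.

Set Implicit Arguments.
Unset Strict Implicit.
Unset Printing Implicit Defensive.

Import Order.TTheory GRing.Theory Num.Theory.
Import numFieldNormedType.Exports.

Local Open Scope classical_set_scope.
Local Open Scope ring_scope.

(* An element of C(X) is represented by a function on the ambient space that
   is continuous within X; its values outside X never matter below.  The
   codomain R[i] carries its norm topology through the alias R[i]^o. *)
Definition cont_on (R : realType) (T : topologicalType) (X : set T)
  : set (T -> R[i]) :=
  [set f | {within X, continuous (f : T -> R[i]^o)}].

(* Suprema are taken in the extended reals, so that an unbounded function or
   operator has norm +oo (a supremum in R would default to 0). *)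
Definition unif_norm (R : realType) (T : topologicalType) (X : set T)
  (f : T -> R[i]) : \bar R :=
  ereal_sup [set (ComplexField.Normc.normc (f t))%:E | t in X].

Definition op_norm (R : realType) (T : topologicalType) (X : set T)
  (L : (T -> R[i]) -> (T -> R[i])) : \bar R :=
  ereal_sup [set unif_norm X (L f) |
             f in [set f | cont_on X f /\ (unif_norm X f <= 1%E)%E]].

Definition simplexH (R : realType) (d : nat) : set 'rV[R]_d.+1 :=
  [set t : 'rV[R]_d.+1 | \sum_i t 0 i = 0 /\
           forall i j : 'I_d.+1, (i < j)%N -> 0 <= t 0 i - t 0 j <= 1].

Arguments simplexH : clear implicits.

Definition latticeH (d : nat) : set 'rV[int]_d.+1 :=
  [set k : 'rV[int]_d.+1 | \sum_i k 0 i = 0 /\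
           forall i j : 'I_d.+1, (k 0%R i = k 0%R j %[mod d.+1%:Z])%Z].

Arguments latticeH : clear implicits.

Definition Lam (d n : nat) : set 'rV[int]_d.+1 :=
  [set k : 'rV[int]_d.+1 | [/\ latticeH d k,
               forall i j : 'I_d.+1, (i < j)%N -> k 0 j <= k 0 i &
               k 0 ord0 <= k 0 ord_max + (d.+1 * n)%N%:Z]].

Definition Lam_int (d n : nat) : set 'rV[int]_d.+1 :=
  [set k : 'rV[int]_d.+1 | [/\ latticeH d k,
               forall i j : 'I_d.+1, (i < j)%N -> k 0 j < k 0 i &
               k 0 ord0 < k 0 ord_max + (d.+1 * n)%N%:Z]].

Arguments Lam : clear implicits.
Arguments Lam_int : clear implicits.

Definition cis (R : realType) (x : R) : R[i] := (cos x +i* sin x)%C.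

Definition phi (R : realType) (d : nat) (k : 'rV[int]_d.+1) (t : 'rV[R]_d.+1)
  : R[i] :=
  cis (2 * pi / d.+1%:R * \sum_i (k 0 i)%:~R * t 0 i).

Definition TC (R : realType) (d : nat) (k : 'rV[int]_d.+1) (t : 'rV[R]_d.+1)
  : R[i] :=
  (d.+1)`!%:R^-1 * \sum_(s : 'S_d.+1) phi k (col_perm s t).

Definition TS (R : realType) (d : nat) (k : 'rV[int]_d.+1) (t : 'rV[R]_d.+1)
  : R[i] :=
  (d.+1)`!%:R^-1 * \sum_(s : 'S_d.+1) (-1) ^+ s * phi k (col_perm s t).

(* The multiplicities [:: p_1; ...; p_l] of the distinct entries of j.  When
   the entries of j are nonincreasing, as in Lam, undup lists the distinct
   ones in decreasing order. *)
Definition mults (d : nat) (j : 'rV[int]_d.+1) : seq nat :=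
  let s := [seq j 0 i | i <- enum 'I_d.+1] in
  [seq count_mem v s | v <- undup s].

Definition lambda (R : realType) (d n : nat) (j : 'rV[int]_d.+1) : R[i] :=
  let p := nth 0%N (mults j) in
  let l := size (mults j) in
  let q :=
    if j 0 ord0 < j 0 ord_max + (d.+1 * n)%N%:Z
    then (\prod_(0 <= m < l) (p m)`!)%N
    else ((p 0 + p l.-1)`! * \prod_(1 <= m < l.-1) (p m)`!)%N in
  (d.+1)`!%:R / q%:R.

Definition node (R : realType) (d n : nat) (j : 'rV[int]_d.+1) : 'rV[R]_d.+1 :=
  (d.+1 * n)%N%:R^-1 *: map_mx intr j.

(* The sums below range over subsets of an infinite lattice and use the library's
   finitely supported sum, which is the ordinary sum since Lam d n and
   Lam_int d n are finite (Lam_finite, Lam_int_finite). *)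
Definition interp (R : realType) (d n : nat) (f : 'rV[R]_d.+1 -> R[i])
  (t : 'rV[R]_d.+1) : R[i] :=
  \sum_(j \in Lam_int d n)
    (f (node R n j) * ((d`! * (d.+1)`!)%N%:R / n%:R ^+ d) *
     \sum_(k \in Lam_int d n) (TS k t * conjc (TS k (node R n j)))).

Definition interp_star (R : realType) (d n : nat) (f : 'rV[R]_d.+1 -> R[i])
  (t : 'rV[R]_d.+1) : R[i] :=
  \sum_(j \in Lam d n)
    (f (node R n j) * (lambda R n j / (d.+1%:R * n%:R ^+ d)) *
     \sum_(k \in Lam d n)
       (lambda R n k * TC k t * conjc (TC k (node R n j)))).

Arguments interp : clear implicits.
Arguments interp_star : clear implicits.

Lemma Lam_finite (d n : nat) : finite_set (Lam d n).
Proof.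
pose N := (d.+1 * n)%N.
pose g (x : {ffun 'I_d.+1 -> 'I_(2 * N).+1}) : 'rV[int]_d.+1 :=
  \row_i ((x i : nat)%:Z - N%:Z).
apply: (@sub_finite_set _ _ (range g)); last exact: finite_image.
move=> k [[sum0 _] dec bnd].
have mono (i j : 'I_d.+1) : (i <= j)%N -> k 0 j <= k 0 i.
  by rewrite leq_eqVlt => /orP[/eqP/val_inj -> //|/dec].
have top i : 0 <= k 0 ord0 - k 0 i.
  by rewrite subr_ge0; apply: mono.
have bot i : k 0 ord_max <= k 0 i by apply: mono; rewrite -ltnS.
have ge0 : 0 <= k 0 ord0.
  rewrite leNgt; apply/negP => lt0.
  suff : \sum_i k 0 i < 0 by rewrite sum0 ltxx.
  rewrite big_ord_recl; apply: ltr_wnDr => //.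
  by apply: sumr_le0 => i _; apply: le_trans (ltW lt0); apply: mono.
have le0 : k 0 ord_max <= 0.
  rewrite leNgt; apply/negP => gt0.
  suff : 0 < \sum_i k 0 i by rewrite sum0 ltxx.
  rewrite big_ord_recl; apply: ltr_wpDr; last exact: lt_le_trans gt0 (bot _).
  by apply: sumr_ge0 => i _; apply: le_trans (ltW gt0) (bot _).
have lo i : 0 <= k 0 i + N%:Z.
  apply: le_trans (lerD (bot i) (lexx _)).
  exact: le_trans ge0 bnd.
have hi i : k 0 i + N%:Z <= (2 * N)%N%:Z.
  rewrite mul2n -addnn PoszD; apply: lerD => //.
  apply: le_trans (_ : k 0 ord0 <= _); first by rewrite -subr_ge0.
  by apply: le_trans bnd _; rewrite -[leRHS]add0r lerD2r.
exists [ffun i => inord (absz (k 0 i + N%:Z))] => //.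
apply/rowP => i; rewrite mxE ffunE inordK; last first.
  by rewrite ltnS -lez_nat gez0_abs.
by rewrite gez0_abs // addrK.
Qed.

Lemma Lam_int_finite (d n : nat) : finite_set (Lam_int d n).
Proof.
apply: sub_finite_set (Lam_finite d n) => k [kH dec bnd].
by split=> //; [move=> i j /dec/ltW | exact: ltW].
Qed.

(* Main.v *)
Require Import Defs.
From mathcomp Require Import all_boot all_order all_algebra perm.
From mathcomp Require Import all_classical all_reals all_analysis.
From mathcomp Require Import complex ring lra zify.

(** The theorem is a bound on Lebesgue constants: if |f| <= 1 on the simplex,
    then both interpolants at t are at most C n^(-d) times the sum, over the
    nodes v, of the modulus of the kernel K(t, v) obtained from the inner sum
    over k.  It has to be shown that this sum of moduli is O((log n)^d).

    Write k in the lattice as k_i = (d+1) m_i - (m_1 + ... + m_(d+1)), with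
    the integer vector m normalised to have least entry 0 ([rowH]).  For u of
    sum zero, phi_k(u) is then the product of the e^(2 pi i m_k u_k), and
    Lam n corresponds to the nonincreasing m with entries in [0, n] and last
    entry 0 ([alcove], [Lam_rowH]).

    The weight lambda_k is the number of rearrangements of m in which every
    entry 0 stands before every entry n ([count_permutations_precedes],
    [lambda_rowH]).  Since TC_k(t) times the conjugate of TC_k(v) does not
    change when the entries of k are permuted, the weighted sum over Lam n is
    the unweighted sum over all those arrangements ([sum_lambda_Lam]).
    Splitting an arrangement at its last entry 0 decomposes the summation set
    into the disjoint boxes
      m_i = 0,   0 <= m_k <= n-1 for k < i,   1 <= m_k <= n for k > i
    ([sum_cell_slabs]).  On a box the sum of the exponentials is a product of
    d geometric sums of at most n terms each, and each of these is at most
    [peak] n u_k, a function comparable with min(n, 1 / |sin (pi u_k)|).  The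
    sine kernel is the same sum restricted to arrangements without the entry
    n, because TS_k vanishes when two entries of k agree ([sine_kernel]).

    So the kernel at a node v is bounded by an average, over permutations s
    and p, of sums over i of the products over k <> i of
    peak n (t_(s k) - v_(p k)) ([normc_cell_kernel_le]).  A node is determined
    by its coordinates other than one, and these lie in a bounded part of the
    grid (1/N) Z with N = (d+1) n.  Hence the sum over the nodes is at most
    the d-th power of a sum of one-dimensional peaks over a grid of mesh 1/N
    ([sum_peaks_le]), which is O(n log n) by comparison with the harmonic
    series ([peak_sum_le]). *)

Set Implicit Arguments.
Unset Strict Implicit.
Unset Printing Implicit Defensive.

Import Order.TTheory GRing.Theory Num.Theory.
Import numFieldNormedType.Exports.
Import ComplexField.Normc.

Local Open Scope classical_set_scope.
Local Open Scope ring_scope.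

(** * The unit circle and moduli of complex numbers *)

Lemma cisD (R : realType) (x y : R) : cis (x + y) = cis x * cis y.
Proof. by rewrite /cis sinD cosD; simpc; rewrite [cos x * sin y + _]addrC. Qed.

Lemma cis0 (R : realType) : cis (0 : R) = 1.
Proof. by rewrite /cis sin0 cos0. Qed.

Lemma conj_cis (R : realType) (x : R) : conjc (cis x) = cis (- x).
Proof. by rewrite /cis sinN cosN. Qed.

Lemma normc_cis (R : realType) (x : R) : normc (cis x) = 1.
Proof. by rewrite /cis /= cos2Dsin2 sqrtr1. Qed.

Lemma cis_sum (R : realType) (I : finType) (x : I -> R) :
  cis (\sum_i x i) = \prod_i cis (x i).
Proof. exact: (big_morph _ (@cisD R) (@cis0 R)). Qed.

Lemma normc_ge0 (R : realType) (z : R[i]) : 0 <= normc z.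
Proof. by case: z => a b; exact: sqrtr_ge0. Qed.

Lemma normc_triangle (R : realType) (x y : R[i]) :
  normc (x + y) <= normc x + normc y :> R.
Proof. exact: le_normcD. Qed.

Lemma normc_opp (R : realType) (x : R[i]) : normc (- x) = normc x :> R.
Proof. exact: normcN. Qed.

Lemma normc_nat (R : realType) (n : nat) : normc (n%:R : R[i]) = n%:R.
Proof. by rewrite -[n%:R]/(1 *+ n) normcMn normc1. Qed.

Lemma normc_sum (R : realType) (I : Type) (r : seq I) (P : pred I)
    (F : I -> R[i]) :
  normc (\sum_(i <- r | P i) F i) <= \sum_(i <- r | P i) normc (F i).
Proof.
elim/big_rec2: _ => [|i y1 y2 _ le12]; first by rewrite normc0.
by apply: le_trans (normc_triangle _ _) _; rewrite lerD2l.
Qed.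

Lemma normc_prod (R : realType) (I : Type) (r : seq I) (P : pred I)
    (F : I -> R[i]) :
  normc (\prod_(i <- r | P i) F i) = \prod_(i <- r | P i) normc (F i).
Proof. exact: (big_morph _ (@normcM R) (@normc1 R)). Qed.

(** * The one-dimensional peaks *)

(** A smooth substitute for min(n, 1 / |sin (pi u)|), which it dominates and of
    which it is at most twice the value: the single formula also covers the
    points where the sine vanishes. *)
Definition peak (R : realType) (n : nat) (u : R) : R :=
  2 * n%:R / (1 + n%:R * `|sin (pi * u)|).

Lemma peak_den_gt0 (R : realType) (n : nat) (u : R) :
  0 < 1 + n%:R * `|sin (pi * u)|.
Proof. by rewrite ltr_wpDr // mulr_ge0. Qed.

Lemma peak_ge0 (R : realType) (n : nat) (u : R) : 0 <= peak n u.
Proof. by rewrite divr_ge0 ?mulr_ge0 // ltW // peak_den_gt0. Qed.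

Lemma peakD1 (R : realType) (n : nat) (u : R) : peak n (u + 1) = peak n u.
Proof. by rewrite /peak mulrDr mulr1 sinDpi normrN. Qed.

Lemma peakN (R : realType) (n : nat) (u : R) : peak n (- u) = peak n u.
Proof. by rewrite /peak mulrN sinN normrN. Qed.

(** The Dirichlet kernel estimate.  The sum D has at most n terms of modulus 1,
    and multiplied by e^(2 pi i u) - 1, of modulus 2 |sin (pi u)|, it telescopes
    to a difference of two unimodular numbers; so |D| <= n and
    |D| |sin (pi u)| <= 1, and adding |D| to n times the second bound gives
    the claim. *)
Lemma geometric_le_peak (R : realType) (n a b : nat) (u : R) :
  (b - a <= n)%N ->
  normc (\sum_(a <= m < b) cis (2 * pi * (m%:R * u))) <= peak n u.
Proof.
move=> ban.
set D := \sum_(_ <= _ < _) _.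
have Dn : normc D <= n%:R.
  apply: le_trans (normc_sum _ _ _) _.
  under eq_bigr do rewrite normc_cis.
  by rewrite sumr_const_nat ler_nat.
have Ds : normc D * `|sin (pi * u)| <= 1.
  have [ab|ba] := leqP a b; last first.
    by rewrite /D big_geq ?(ltnW ba) // normc0 mul0r.
  have tel : D * (cis (2 * pi * u) - 1)
      = cis (2 * pi * (b%:R * u)) - cis (2 * pi * (a%:R * u)).
    rewrite /D mulr_suml -(telescope_sumr (fun m => cis (2 * pi * (m%:R * u)))) //.
    apply: eq_bigr => m _.
    by rewrite mulrBr mulr1 -cisD -natr1; congr (cis _ - _); ring.
  have fac : cis (2 * pi * u) - 1 = (0 +i* (2 * sin (pi * u)))%C * cis (pi * u).
    rewrite -mulrA mulr_natl /cis cos_mulr2n sin_mulr2n.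
    have := cos2Dsin2 (pi * u); set c := cos _; set s := sin _ => cs.
    have -> : (1 : R[i]) = (1 +i* 0)%C by [].
    simpc.
    by apply/eqP; rewrite eq_complex /=; apply/andP; split; apply/eqP; [nra|ring].
  have nfac : normc (cis (2 * pi * u) - 1) = 2 * `|sin (pi * u)|.
    rewrite fac normcM normc_cis mulr1 /= expr0n /= add0r sqrtr_sqr normrM.
    by rewrite ger0_norm.
  have : normc D * (2 * `|sin (pi * u)|) <= 2.
    rewrite -nfac -normcM tel.
    have := normc_triangle (cis (2 * pi * (b%:R * u)))
                           (- cis (2 * pi * (a%:R * u))).
    by rewrite normc_opp !normc_cis.
  by move=> h; lra.
rewrite /peak ler_pdivlMr ?peak_den_gt0 //.
rewrite mulrDr mulr1 mulrCA.
have : n%:R * (normc D * `|sin (pi * u)|) <= n%:R * 1 :> R by rewrite ler_wpM2l.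
lra.
Qed.

(** A crude form of Jordan's inequality; only the linear order of magnitude of
    the sine near 0 matters. *)
Lemma sin_ge_quarter (R : realType) (x : R) :
  0 <= x <= pi / 2 -> x / 4 <= sin x.
Proof.
move=> /andP[x0 x1].
have p2 := pihalf_lt2 R.
have pp := pi_gt0 R.
(* The slope of the sine on [0, pi/4] is at least cos (pi/4), which is at least
   1/2 by the double angle formula. *)
have c4 : 2^-1 <= cos (pi / 4 : R).
  have h : 2 * (cos (pi / 4) ^+ 2) = 1 :> R.
    have := cos_mulr2n (pi / 4 : R).
    have -> : pi / 4 *+ 2 = pi / 2 :> R by rewrite -mulr_natr; field.
    by rewrite cos_pihalf => e; lra.
  have : 0 <= cos (pi / 4 : R) by apply: cos_ge0_pihalf; lra.
  have := cos_le1 (pi / 4 : R).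
  nra.
have small (y : R) : 0 <= y <= pi / 4 -> y / 2 <= sin y.
  move=> /andP[y0 y4].
  move: y0; rewrite le_eqVlt => /orP[/eqP <-|y0]; first by rewrite mul0r sin0.
  have [z /[!in_itv]/= /andP[z0 zy]] := @MVT R (@sin R) (@cos R) 0 y y0
    (fun x _ => is_derive_sin x) (@continuous_subspaceT _ _ _ _ (@continuous_sin R)).
  rewrite sin0 !subr0 => ->.
  rewrite mulrC ler_wpM2r ?(ltW y0) //.
  apply: le_trans c4 _.
  have [->//|ne] := eqVneq z (pi / 4).
  by apply/ltW; rewrite ltr_cos ?in_itv /=; lra.
have [x4|x4] := leP x (pi / 4); first by have := small x; lra.
have s4 : pi / 4 / 2 <= sin (pi / 4 : R) by apply: small; lra.
have : sin (pi / 4 : R) < sin x by rewrite ltr_sin ?in_itv /=; lra.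
lra.
Qed.

(** |sin (pi u)| is at least half the distance from u to the nearer of the
    zeros 0 and 1. *)
Lemma abs_sin_pi_ge (R : realType) (u : R) : 0 <= u <= 1 ->
  u / 2 <= `|sin (pi * u)| \/ (1 - u) / 2 <= `|sin (pi * u)|.
Proof.
move=> /andP[u0 u1].
have p2 := pi_ge2 R.
have half (v : R) : 0 <= v <= 2^-1 -> v / 2 <= `|sin (pi * v)|.
  move=> /andP[v0 v1].
  apply: le_trans (ler_norm _); apply: le_trans (sin_ge_quarter _); nra.
have [uh|uh] := leP u 2^-1; first by left; apply: half; lra.
right; have -> : sin (pi * u) = sin (pi * (1 - u)).
  by rewrite mulrBr mulr1 addrC sinDpi sinN opprK.
apply: half; lra.
Qed.

(** At the (r+1)-st point of the grid of mesh 1/N in [0, 1) the peaks at 0 and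
    at 1 contribute like 1/(r+1) and 1/(N-r).  Adding 1 in the denominator of
    [peak] absorbs the offset theta and the two end points. *)
Lemma peak_le_harmonic (R : realType) (n K N r : nat) (theta : R) :
  (0 < n)%N -> (0 < K)%N -> N = (K * n)%N -> (r < N)%N -> 0 <= theta < 1 ->
  peak n ((theta + r%:R) / N%:R)
    <= (4 * K * n)%N%:R * (r.+1%:R^-1 + (N - r)%N%:R^-1).
Proof.
move=> n0 K0 NE rN /andP[t0 t1].
set u := _ / _.
have nR : 0 < n%:R :> R by rewrite ltr0n.
have KR : 1 <= K%:R :> R by rewrite ler1n.
have NR : N%:R = K%:R * n%:R :> R by rewrite NE natrM.
have rNR : r.+1%:R <= N%:R :> R by rewrite ler_nat.
have rR : 0 <= r%:R :> R by [].
move: rNR; rewrite -natr1 => rNR.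
have N0 : 0 < N%:R :> R by lra.
have uN : u * N%:R = theta + r%:R by rewrite /u mulfVK // gt_eqF.
have u01 : 0 <= u <= 1.
  by rewrite divr_ge0 /= ?addr_ge0 ?(ltW N0) // ler_pdivrMr //; lra.
have key (x : R) : 0 < x -> x <= 2 * K%:R * (1 + n%:R * `|sin (pi * u)|) ->
    peak n u <= (4 * K * n)%N%:R * x^-1.
  move=> x0 xle; rewrite /peak ler_pdivrMr ?peak_den_gt0 //.
  rewrite mulrAC ler_pdivlMr // !natrM.
  have : n%:R * x <= n%:R * (2 * K%:R * (1 + n%:R * `|sin (pi * u)|)).
    by rewrite ler_pM2l.
  lra.
have NrR : (N - r)%N%:R = N%:R - r%:R :> R by rewrite natrB // ltnW.
rewrite [X in _ <= X]mulrDr ?natr1.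
have h (m : nat) : 0 <= (4 * K * n)%N%:R * m%:R^-1 :> R.
  by rewrite mulr_ge0 // invr_ge0.
have [s1|s1] := abs_sin_pi_ge u01.
- apply: le_trans (_ : _ <= (4 * K * n)%N%:R * r.+1%:R^-1) _; last first.
    by rewrite lerDl h.
  apply: key; first by rewrite ltr0n.
  have : n%:R * K%:R * (u / 2) <= n%:R * K%:R * `|sin (pi * u)|.
    by rewrite ler_wpM2l //; nra.
  rewrite -natr1; nra.
- apply: le_trans (_ : _ <= (4 * K * n)%N%:R * (N - r)%N%:R^-1) _; last first.
    by rewrite lerDr h.
  apply: key; first by rewrite ltr0n subn_gt0.
  have : n%:R * K%:R * ((1 - u) / 2) <= n%:R * K%:R * `|sin (pi * u)|.
    by rewrite ler_wpM2l //; nra.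
  rewrite NrR; nra.
Qed.

Lemma harmonic_le_ln (R : realType) (N : nat) : (0 < N)%N ->
  \sum_(r < N) (r.+1%:R^-1 : R) <= 1 + ln N%:R.
Proof.
case: N => // N _; elim: N => [|N IH].
  by rewrite big_ord1 ln1 addr0 invr1.
rewrite big_ord_recr /=.
suff : N.+2%:R^-1 <= ln N.+2%:R - ln N.+1%:R :> R.
  by move=> h; apply: le_trans (lerD IH h) _; rewrite -addrA [_ + (_ - _)]addrC subrK.
have x0 : 0 < N.+2%:R^-1 :> R by rewrite invr_gt0 ltr0n.
have x1 : N.+2%:R^-1 < 1 :> R by rewrite invf_lt1 ?ltr0n // ltr1n.
have := @le_ln1Dx R (- N.+2%:R^-1).
have -> : 1 - N.+2%:R^-1 = N.+1%:R / N.+2%:R :> R.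
  rewrite -[N.+2%:R]natr1; move: N.+1%:R (ltr0Sn R N) => a a0.
  by field; rewrite gt_eqF // addr_gt0.
rewrite ln_div ?posrE ?ltr0n //.
by move=> h; have := h ltac:(rewrite ltrN2 //); rewrite lerNr opprB.
Qed.

(** As [peak] has period 1, its sum over a full period of the grid of mesh 1/N
    is invariant under shifts by the mesh. *)
Lemma peak_period_sum (R : realType) (n N : nat) (tau : R) (z : int) :
  (0 < N)%N ->
  \sum_(p < N) peak n (tau + z%:~R / N%:R + p%:R / N%:R)
    = \sum_(p < N) peak n (tau + p%:R / N%:R).
Proof.
move=> N0.
have NR : N%:R != 0 :> R by rewrite pnatr_eq0 -lt0n.
have step (t : R) : \sum_(p < N) peak n (t + N%:R^-1 + p%:R / N%:R)
    = \sum_(p < N) peak n (t + p%:R / N%:R).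
  case: N N0 NR => // N _ NR.
  rewrite big_ord_recr big_ord_recl /= addrC; congr (_ + _).
    rewrite mul0r addr0 -[RHS]peakD1; congr (peak n _).
    by rewrite -[N.+1%:R]natr1 in NR *; field.
  apply: eq_bigr => i _; congr (peak n _).
  by rewrite /bump /= add1n -[i.+1%:R]natr1; field.
have nstep (m : nat) (t : R) :
    \sum_(p < N) peak n (t + m%:R / N%:R + p%:R / N%:R)
    = \sum_(p < N) peak n (t + p%:R / N%:R).
  elim: m t => [|m IH] t.
    by apply: eq_bigr => i _; rewrite mul0r addr0.
  rewrite -[RHS]IH -[RHS]step; apply: eq_bigr => i _; congr (peak n _).
  by rewrite -natr1; field.
case: (intP z) => [|m|m]; first by apply: eq_bigr => i _; rewrite mul0r addr0.
  exact: nstep.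
rewrite -(nstep m.+1); apply: eq_bigr => i _; congr (peak n _).
by rewrite mulrNz; field.
Qed.

(** The number M of periods is free since the coordinates of the nodes run
    through a window longer than one period. *)
Lemma peak_sum_le (R : realType) (n K M N : nat) (tau : R) :
  (0 < n)%N -> (0 < K)%N -> N = (K * n)%N ->
  \sum_(p < M * N) peak n (tau + p%:R / N%:R)
    <= (8 * M * K * n)%N%:R * (1 + ln N%:R).
Proof.
move=> n0 K0 NE.
have N0 : (0 < N)%N by rewrite NE muln_gt0 n0 K0.
have NR : 0 < N%:R :> R by rewrite ltr0n.
have one (t : R) : \sum_(p < N) peak n (t + p%:R / N%:R)
    <= (8 * K * n)%N%:R * (1 + ln N%:R).
  (* Shift t by a multiple of the mesh into [0, 1/N). *)
  pose z := Num.floor (t * N%:R).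
  pose theta := t * N%:R - z%:~R.
  have th : 0 <= theta < 1.
    have := floor_itv (t * N%:R); rewrite -/z /theta intrD /=; lra.
  have tE : t = theta / N%:R + z%:~R / N%:R.
    by rewrite -mulrDl subrK mulfK // gt_eqF.
  rewrite {1}tE peak_period_sum //.
  apply: le_trans (_ : \sum_(p < N)
     (4 * K * n)%N%:R * (p.+1%:R^-1 + (N - p)%N%:R^-1) <= _).
    apply: ler_sum => p _; rewrite -mulrDl.
    exact: (peak_le_harmonic n0 K0 NE).
  rewrite -mulr_sumr big_split /=.
  have -> : \sum_(p < N) (N - p)%N%:R^-1 = \sum_(p < N) p.+1%:R^-1 :> R.
    rewrite (reindex_inj rev_ord_inj) /=; apply: eq_bigr => p _.
    by rewrite subKn.
  have -> : (8 * K * n = 4 * K * n * 2)%N by lia.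
  rewrite [X in _ <= X * _]natrM -[X in _ <= X]mulrA ler_wpM2l // mulr_natl mulr2n.
  by rewrite lerD // harmonic_le_ln.
elim: M tau => [|M IH] tau; first by rewrite mul0n big_ord0 muln0 !mul0n mul0r.
rewrite mulSn big_split_ord /=.
under [X in _ + X]eq_bigr => p _.
  have -> : tau + (N + p)%N%:R / N%:R = tau + 1 + p%:R / N%:R.
    by rewrite natrD; field; rewrite gt_eqF.
  over.
have -> : (8 * M.+1 * K * n = 8 * K * n + 8 * M * K * n)%N by lia.
by rewrite natrD mulrDl lerD.
Qed.

(** * Counting rearrangements in which one letter precedes another *)

Definition precedes (A : eqType) (a b : A) (s : seq A) : bool :=
  pairwise (fun x y => ~~ ((x == b) && (y == a))) s.

(** The order of the group of permutations that fix a word once its letters a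
    and b have been identified. *)
Definition merged_fact (A : finType) (a b : A) (s : seq A) : nat :=
  ((count_mem a s + count_mem b s)`! *
   \prod_(v | (v != a) && (v != b)) (count_mem v s)`!)%N.

Lemma sum_count_mem (A : finType) (s : seq A) :
  (\sum_(v : A) count_mem v s = size s)%N.
Proof.
elim: s => [|x s IH] /=; first by rewrite big1.
rewrite big_split /= IH (bigD1 x) //= eqxx big1 ?addn0 // => v /negPf.
by rewrite eq_sym => ->.
Qed.

Lemma sum_nat_D2 (A : finType) (a b : A) (F : A -> nat) : a != b ->
  (\sum_v F v = F a + F b + \sum_(v | (v != a) && (v != b)) F v)%N.
Proof.
by move=> ab; rewrite (bigD1 a) //= (bigD1 b) 1?eq_sym //= addnA.
Qed.

Lemma merged_fact_rem (A : finType) (a b : A) (s : seq A) (x : A) : a != b ->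
  x \in s ->
  merged_fact a b s
    = ((if (x == a) || (x == b) then count_mem a s + count_mem b s
        else count_mem x s) * merged_fact a b (rem x s))%N.
Proof.
move=> ab; rewrite -has_pred1 has_count => xs.
have factE k : (0 < k)%N -> (k`! = k * (k - 1)`!)%N.
  by case: k => // k _; rewrite factS subn1.
rewrite /merged_fact !count_mem_rem.
have [xab|] := boolP ((x == a) || (x == b)).
  rewrite mulnA; congr (_ * _)%N.
    case/orP: xab xs => /eqP -> xs; rewrite eqxx ?(negPf ab) 1?eq_sym ?(negPf ab).
      by rewrite subn0 factE ?addn_gt0 ?xs // addnBAC.
    by rewrite subn0 factE ?addn_gt0 ?xs ?orbT // addnBA.
  apply: eq_bigr => v /andP[va vb]; rewrite count_mem_rem.
  by case/orP: xab => /eqP ->; rewrite eq_sym ?(negPf va) ?(negPf vb) subn0.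
rewrite negb_or => /andP[xa xb]; rewrite (negPf xa) (negPf xb) !subn0.
rewrite (bigD1 x) ?xa //= [in RHS](bigD1 x) ?xa //= count_mem_rem eqxx.
rewrite (factE _ xs) [RHS]mulnCA -!mulnA; congr (_ * (_ * (_ * _)))%N.
apply: eq_bigr => v /andP[_ vx]; rewrite count_mem_rem.
by rewrite eq_sym (negPf vx) subn0.
Qed.

(** Identifying b with a is injective on the rearrangements of s in which a
    precedes b, and reaches every rearrangement of the identified word; so
    their number is the multinomial coefficient (size s)! / merged_fact.  The
    proof is an induction on the first letter x: the arrangements starting
    with x number (size s - 1)! w(x) / merged_fact, where w(x) is the
    multiplicity of x, except that b may come first only if there is no a,
    while a carries the multiplicity of both. *)
Lemma count_permutations_precedes (A : finType) (a b : A) (s : seq A) : a != b ->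
  (count (precedes a b) (permutations s) * merged_fact a b s
    = (size s)`!)%N.
Proof.
move=> ab; have [k] := ubnP (size s); elim: k s => // k IH s.
rewrite ltnS; case: (posnP (size s)) => [/size0nil -> _|s0 sk].
  by rewrite /merged_fact /= big1 // mul1n.
rewrite (seq.permP (permutationsE s0)) count_flatten sumnE !big_map.
under eq_bigr do rewrite count_map.
rewrite big_distrl /=.
pose w x := (if x == a then (a \in s) * (count_mem a s + count_mem b s)
             else if x == b then (a \notin s) * count_mem b s
             else count_mem x s)%N.
transitivity (\sum_(x <- undup s) w x * (size s).-1`!)%N.
  rewrite !big_seq; apply: eq_bigr => x; rewrite mem_undup => xs.
  rewrite (merged_fact_rem ab xs).
  have szr : size (rem x s) = (size s).-1 by rewrite size_rem.
  have IHx : (count (precedes a b) (permutations (rem x s))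
      * merged_fact a b (rem x s) = (size s).-1`!)%N.
    by rewrite IH szr // prednK.
  rewrite mulnCA /w.
  have notb : x != b -> count (preim (cons x) (precedes a b))
       (permutations (rem x s)) = count (precedes a b) (permutations (rem x s)).
    move=> xb; apply: eq_count => t /=; rewrite /precedes /=.
    by rewrite (negPf xb) all_predT.
  have [xa|xa] := eqVneq x a.
    have a_s : a \in s by rewrite -xa.
    rewrite notb; last by rewrite xa.
    by rewrite IHx a_s mul1n.
  have [xb|xb] := eqVneq x b; last by rewrite notb // IHx.
  have [a_s|a_s] /= := boolP (a \in s).
    rewrite mul0n [X in (_ * (X * _))%N](_ : _ = 0)%N ?mul0n ?muln0 //.
    rewrite (@eq_in_count _ _ pred0) ?count_pred0 // => t.
    rewrite mem_permutations => /perm_mem pt /=.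
    rewrite /precedes /=; apply/negbTE/nandP; left.
    apply/allPn; exists a; last by rewrite xb !eqxx.
    rewrite pt; apply: contraLR a_s.
    by rewrite [a \in s](perm_mem (perm_to_rem xs)) inE xb (negPf ab).
  rewrite mul1n (count_memPn a_s) add0n; congr (_ * _)%N.
  rewrite -IHx; congr (_ * _)%N; apply: eq_in_count => t.
  rewrite mem_permutations => /perm_mem pt /=.
  rewrite /precedes /=; case: pairwise; rewrite ?andbF ?andbT //.
  apply/allP => y; rewrite pt => /mem_rem ys.
  by rewrite negb_and (memPn a_s _ ys) orbT.
rewrite -big_distrl /= -[in RHS](prednK s0) factS (prednK s0); congr (_ * _)%N.
rewrite big_uniq ?undup_uniq //=.
under eq_bigl do rewrite mem_undup.
rewrite big_mkcond /= -[RHS]sum_count_mem.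
rewrite !(sum_nat_D2 _ ab); congr (_ + _)%N; last first.
  apply: eq_bigr => v /andP[va vb]; rewrite /w (negPf va) (negPf vb).
  by case: ifP => // /negbT/count_memPn ->.
rewrite /w eqxx [b == a]eq_sym (negPf ab) eqxx.
have [a_s|a_s] /= := boolP (a \in s).
  by rewrite mul1n mul0n if_same addn0.
rewrite mul1n add0n (count_memPn a_s) add0n.
by case: ifP => // /negbT/count_memPn ->.
Qed.

Lemma codom_ffun_inj (A : Type) (k : nat) : injective
  (fun m : {ffun 'I_k -> A} => codom m).
Proof.
by move=> m m' /eq_in_map e; apply/ffunP => i; apply: e; rewrite mem_enum.
Qed.

(** Passes from the list of distinct rearrangements of a word to the finite
    functions that have this word as a rearrangement of their graph. *)
Lemma card_arrangements (A : finType) (k : nat) (P : pred (seq A)) (s : seq A) :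
  size s = k ->
  #|[pred m : {ffun 'I_k -> A} | P (codom m) && perm_eq (codom m) s]|
    = count P (permutations s).
Proof.
move=> sk; rewrite -size_filter cardE.
rewrite -(size_map (fun m : {ffun 'I_k -> A} => codom m)).
apply/perm_size/uniq_perm.
- by rewrite map_inj_uniq ?enum_uniq //; exact: codom_ffun_inj.
- by rewrite filter_uniq // permutations_uniq.
move=> t; rewrite mem_filter mem_permutations.
apply/mapP/andP => [[m]|[Pt pt]].
  by rewrite mem_enum => /andP[Pm pm] ->.
have st : size t = k by rewrite (perm_size pt).
case: (posnP k) => [k0|k0].
  have t0 : t = [::] by apply: size0nil; rewrite st.
  have cn (m : {ffun 'I_k -> A}) : codom m = [::].
    by apply: size0nil; rewrite size_codom card_ord.
  have m : {ffun 'I_k -> A} by apply: finfun; rewrite k0; case.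
  by exists m; rewrite ?cn // mem_enum inE cn -t0 Pt.
have x0 : A by case: t st {Pt pt} => [/= e|x _ _]; [rewrite -e in k0|exact: x].
pose m := [ffun i : 'I_k => nth x0 t i].
have cm : codom m = t.
  apply: (@eq_from_nth _ x0) => [|i]; first by rewrite size_codom card_ord.
  rewrite size_codom card_ord => ik.
  by rewrite codomE (nth_map (Ordinal ik)) ?size_enum_ord // ffunE nth_enum_ord.
by exists m; rewrite ?cm // mem_enum inE cm Pt.
Qed.

Lemma nth_codom_ord (A : Type) (k : nat) (m : 'I_k -> A) (x0 : A) (i : 'I_k) :
  nth x0 (codom m) i = m i.
Proof. by rewrite codomE (nth_map i) ?size_enum_ord // nth_ord_enum. Qed.

(** * Lattice points as integer vectors with least entry zero *)

(** The restriction to vectors with entries in [0, n] of the isomorphism from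
    Z^(d+1) modulo the diagonal onto the lattice of the interpolation
    problem. *)
Definition rowH (d n : nat) (m : {ffun 'I_d.+1 -> 'I_n.+1}) : 'rV[int]_d.+1 :=
  \row_i (d.+1%:Z * (m i)%:Z - \sum_j (m j)%:Z).

Definition noninc (d n : nat) (m : {ffun 'I_d.+1 -> 'I_n.+1}) : bool :=
  sorted (fun x y : 'I_n.+1 => (y <= x)%N) (codom m).

Definition alcove (d n : nat) (m : {ffun 'I_d.+1 -> 'I_n.+1}) : bool :=
  noninc m && (m ord_max == ord0).

Lemma geq_ord_trans (n : nat) : transitive (fun x y : 'I_n => (y <= x)%N).
Proof. by move=> y x z yx zy; exact: leq_trans zy yx. Qed.

Lemma noninc_le (d n : nat) (m : {ffun 'I_d.+1 -> 'I_n.+1}) :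
  reflect (forall i j : 'I_d.+1, (i < j)%N -> (m j <= m i)%N) (noninc m).
Proof.
rewrite /noninc (sorted_pairwise (@geq_ord_trans _)).
have sz : size (codom m) = d.+1 by rewrite size_codom card_ord.
apply: (iffP (pairwiseP ord0)) => [h i j ij|h i j].
  by have := h i j; rewrite !inE !sz !nth_codom_ord; apply.
rewrite !inE !sz => id jd ij.
by have := h (Ordinal id) (Ordinal jd) ij; rewrite -!(nth_codom_ord m ord0).
Qed.

Definition sortH (d n : nat) (m : {ffun 'I_d.+1 -> 'I_n.+1}) :=
  [ffun i : 'I_d.+1 =>
     nth ord0 (sort (fun x y : 'I_n.+1 => (y <= x)%N) (codom m)) i].

Lemma codom_sortH (d n : nat) (m : {ffun 'I_d.+1 -> 'I_n.+1}) :
  codom (sortH m) = sort (fun x y : 'I_n.+1 => (y <= x)%N) (codom m).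
Proof.
have sz : size (sort (fun x y : 'I_n.+1 => (y <= x)%N) (codom m)) = d.+1.
  by rewrite size_sort size_codom card_ord.
apply: (@eq_from_nth _ ord0) => [|i]; first by rewrite sz size_codom card_ord.
rewrite size_codom card_ord => id.
by rewrite (nth_codom_ord _ _ (Ordinal id)) ffunE.
Qed.

Lemma sortH_noninc (d n : nat) (m : {ffun 'I_d.+1 -> 'I_n.+1}) :
  noninc (sortH m).
Proof. by rewrite /noninc codom_sortH sort_sorted // => x y; exact: leq_total. Qed.

Lemma perm_sortH (d n : nat) (m : {ffun 'I_d.+1 -> 'I_n.+1}) :
  perm_eq (codom (sortH m)) (codom m).
Proof. by rewrite codom_sortH perm_sort. Qed.

Lemma sortH_eq (d n : nat) (m m' : {ffun 'I_d.+1 -> 'I_n.+1}) :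
  noninc m' -> (sortH m == m') = perm_eq (codom m) (codom m').
Proof.
move=> sm'; apply/eqP/idP => [<-|pm]; first by rewrite perm_sym perm_sortH.
apply: codom_ffun_inj; apply: (sorted_eq (@geq_ord_trans _)) => //.
- by move=> x y /anti_leq/val_inj.
- exact: sortH_noninc.
- exact: perm_trans (perm_sortH m) pm.
Qed.

Lemma rowH_perm (d n : nat) (m m' : {ffun 'I_d.+1 -> 'I_n.+1}) :
  perm_eq (codom m) (codom m') ->
  exists s : 'S_d.+1, rowH m = col_perm s (rowH m').
Proof.
move=> pm.
have pm' : perm_eq (codom m) (mktuple m') by rewrite /= -codomE.
have [s e] := elimT tuple_permP pm'.
have ms i : m i = m' (s i).
  have := congr1 (fun t => nth ord0 t i) e.
  by rewrite nth_codom_ord nth_mktuple tnth_mktuple.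
exists s; apply/rowP => i; rewrite !mxE ms; congr (_ - _).
rewrite [in RHS](reindex_inj (@perm_inj _ s)) /=.
by apply: eq_bigr => j _; rewrite ms.
Qed.

Lemma rowH_sub (d n : nat) (m : {ffun 'I_d.+1 -> 'I_n.+1}) (i j : 'I_d.+1) :
  rowH m 0 i - rowH m 0 j = d.+1%:Z * ((m i)%:Z - (m j)%:Z).
Proof. by rewrite !mxE; ring. Qed.

Lemma sum_rowH (d n : nat) (m : {ffun 'I_d.+1 -> 'I_n.+1}) :
  \sum_i rowH m 0 i = 0.
Proof.
under eq_bigr do rewrite mxE.
by rewrite big_split /= -mulr_sumr sumr_const card_ord mulNrn -mulr_natl natz subrr.
Qed.

Lemma rowH_abs_le (d n : nat) (m : {ffun 'I_d.+1 -> 'I_n.+1}) (i : 'I_d.+1) :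
  `|rowH m 0 i| <= (d.+1 * n)%N%:Z.
Proof.
have mn j : (m j <= n)%N by rewrite -ltnS.
have S0 : 0 <= \sum_j (m j)%:Z by apply: sumr_ge0.
have S1 : \sum_j (m j)%:Z <= (d.+1 * n)%N%:Z.
  apply: le_trans (_ : \sum_(j < d.+1) n%:Z <= _).
    by apply: ler_sum => j _; rewrite lez_nat.
  by rewrite sumr_const card_ord -mulr_natl natz -PoszM.
have := mn i; rewrite mxE; nia.
Qed.

Lemma latticeH_rowH (d n : nat) (m : {ffun 'I_d.+1 -> 'I_n.+1}) :
  latticeH d (rowH m).
Proof.
split=> [|i j]; first exact: sum_rowH.
by apply/eqP; rewrite eqz_mod_dvd rowH_sub dvdz_mulr.
Qed.

Lemma rowH_inj (d n : nat) (m m' : {ffun 'I_d.+1 -> 'I_n.+1}) :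
  alcove m -> alcove m' -> rowH m = rowH m' -> m = m'.
Proof.
move=> /andP[_ /eqP m0] /andP[_ /eqP m0'] e.
apply/ffunP => i; apply: val_inj => /=.
have := rowH_sub m i ord_max; rewrite e rowH_sub m0 m0' /= !subr0.
by move=> /(mulfI (isT : d.+1%:Z != 0)) [].
Qed.

(** The inverse of [rowH] on Lam n is m_i = (k_i - k_(d+1)) / (d+1): the
    congruences make it integral, and k of sum zero recovers k_(d+1) as minus
    the sum of the m_i. *)
Lemma Lam_rowH (d n : nat) :
  Lam d n = @rowH d n @` [set` @alcove d n].
Proof.
apply/seteqP; split=> [k [[k0 kmod] kle ktop]|k /= [m /andP[/noninc_le mle /eqP m0] <-]].
  have [q kE qn] : exists2 q : 'I_d.+1 -> nat,
      forall i, k 0 i = k 0 ord_max + d.+1%:Z * (q i)%:Z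
      & forall i, (q i <= n)%N.
    have le1 (j : 'I_d.+1) : k 0 ord_max <= k 0 j.
      have [->//|ne] := eqVneq j ord_max.
      by apply: kle; rewrite ltn_neqAle -ltnS ltn_ord andbT.
    have le2 (j : 'I_d.+1) : k 0 j <= k 0 ord0.
      have [->//|ne] := eqVneq j ord0.
      by apply: kle; rewrite lt0n.
    have dv i : (d.+1%:Z %| (k 0%R i - k 0%R ord_max)%R)%Z.
      by rewrite -eqz_mod_dvd; apply/eqP.
    exists (fun i => `|((k 0%R i - k 0%R ord_max)%R %/ d.+1%:Z)%Z|%N) => i.
      rewrite gez0_abs ?divz_ge0 ?subr_ge0 //.
      by rewrite mulrC divzK // addrC subrK.
    rewrite -lez_nat gez0_abs ?divz_ge0 ?subr_ge0 //.
    rewrite -(ler_pM2r (_ : 0 < d.+1%:Z)) // divzK //.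
    by have := le2 i; move: ktop; rewrite PoszM; lia.
  have kmax : k 0 ord_max = - \sum_i (q i)%:Z.
    move: k0; under eq_bigr do rewrite kE.
    rewrite big_split /= -mulr_sumr sumr_const card_ord -mulr_natl natz.
    by rewrite -mulrDr => /eqP; rewrite mulf_eq0 /= addr_eq0 => /eqP.
  have qE i : ((inord (q i) : 'I_n.+1) : nat) = q i by rewrite inordK ?ltnS.
  exists [ffun i => inord (q i)].
    apply/andP; split.
      apply/noninc_le => i j ij; rewrite !ffunE !qE.
      rewrite -lez_nat -(ler_pM2l (_ : 0 < d.+1%:Z)) //.
      by have := kle _ _ ij; rewrite (kE i) (kE j) lerD2l.
    rewrite ffunE; apply/eqP/val_inj; rewrite /= qE.
    have /eqP := kE ord_max.
    by rewrite addrC -subr_eq subrr eq_sym mulf_eq0 /= => /eqP[].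
  apply/rowP => i; rewrite mxE ffunE qE.
  under eq_bigr do rewrite ffunE qE.
  by rewrite (kE i) [RHS]addrC kmax.
split; first exact: latticeH_rowH.
- move=> i j /mle ij.
  by rewrite -subr_ge0 rowH_sub mulr_ge0 // subr_ge0 lez_nat.
- rewrite addrC -lerBlDr rowH_sub m0 subr0 PoszM ler_wpM2l // lez_nat.
  by rewrite -ltnS.
Qed.

Lemma fsbig_Lam (V : nmodType) (d n : nat) (F : 'rV[int]_d.+1 -> V) :
  \sum_(k \in Lam d n) F k = \sum_(m | @alcove d n m) F (rowH m).
Proof.
rewrite Lam_rowH fsbig_image; last first.
  by move=> m m' /set_mem am /set_mem am'; exact: rowH_inj.
by rewrite [RHS]bigfs ?index_enum_uniq // => m _; rewrite mem_index_enum.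
Qed.

Lemma merged_fact_gt0 (A : finType) (a b : A) (s : seq A) :
  (0 < merged_fact a b s)%N.
Proof.
rewrite muln_gt0 fact_gt0 /=; apply: prodn_cond_gt0 => v _; exact: fact_gt0.
Qed.

Lemma mults_rowH (d n : nat) (m : {ffun 'I_d.+1 -> 'I_n.+1}) :
  mults (rowH m)
    = [seq count_mem v (codom m) | v <- undup (codom m)].
Proof.
rewrite /mults.
pose g (x : 'I_n.+1) : int := d.+1%:Z * x%:Z - \sum_j (m j)%:Z.
have gI : injective g.
  by move=> x y /addIr/(mulfI (isT : d.+1%:Z != 0)) [] /val_inj.
have -> : [seq rowH m 0 i | i <- enum 'I_d.+1] = map g (codom m).
  by rewrite codomE -map_comp; apply: eq_map => i; rewrite mxE.
rewrite undup_map_inj // -map_comp; apply: eq_map => v /=.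
by rewrite count_map; apply: eq_count => x /=; rewrite (inj_eq gI).
Qed.

Lemma prod_nth_fact (A : Type) (c : A -> nat) (u : seq A) :
  (\prod_(0 <= k < size u) (nth 0%N (map c u) k)`! = \prod_(v <- u) (c v)`!)%N.
Proof.
by rewrite -[RHS](big_map c xpredT factorial) [RHS](big_nth 0%N) size_map.
Qed.

(** When the first entry is n, the list of distinct entries begins with n and
    ends with 0, so that the factor (p_1 + p_l)! of lambda merges exactly
    these two values; otherwise n does not occur and merging has no effect. *)
Lemma lambda_rowH (R : realType) (d n : nat) (m : {ffun 'I_d.+1 -> 'I_n.+1}) :
  (0 < n)%N -> alcove m ->
  lambda R n (rowH m)
    = (d.+1)`!%:R / (merged_fact ord0 ord_max (codom m))%:R.
Proof.
move=> n0 /andP[ni /eqP m0].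
have ab : (ord0 : 'I_n.+1) != ord_max by rewrite -val_eqE /= eq_sym -lt0n.
rewrite /lambda mults_rowH; congr (_ / _%:R).
set s := codom m; set c := fun v => count_mem v s.
have -> : (rowH m 0 ord0 < rowH m 0 ord_max + (d.+1 * n)%N%:Z)
    = (m ord0 != ord_max).
  rewrite addrC -ltrBlDr rowH_sub m0 subr0 PoszM ltr_pM2l // ltz_nat.
  by rewrite -val_eqE /= ltn_neqAle -ltnS ltn_ord andbT.
rewrite size_map -/s.
have s0 : ord0 \in s by rewrite -m0 codom_f.
have su v : (v \in undup s) = (v \in s) by rewrite mem_undup.
have rest (u : seq 'I_n.+1) : uniq u ->
    (forall v, (v \in u) = [&& v \in s, v != ord0 & v != ord_max]) ->
    (\prod_(v <- u) (c v)`!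
      = \prod_(v | (v != ord0) && (v != ord_max)) (c v)`!)%N.
  move=> uu ue; rewrite big_uniq //= big_mkcond [RHS]big_mkcond /=.
  apply: eq_bigr => v _; rewrite ue.
  by have [//|/count_memPn] := boolP (v \in s); rewrite /c /= => ->; rewrite if_same.
case: ifPn => mM.
  rewrite prod_nth_fact /merged_fact -/s.
  have sM : (ord_max \in s) = false.
    apply/negP => /codomP[i mi]; have := mM; rewrite -val_eqE /= => /negP; apply.
    rewrite eqn_leq -ltnS ltn_ord /=.
    suff: (m i <= m ord0)%N by rewrite -mi.
    have [->//|ne] := eqVneq i ord0.
    by move/noninc_le: ni; apply; rewrite lt0n.
  rewrite (count_memPn (negbT sM)) addn0.
  rewrite (perm_big (ord0 :: rem ord0 (undup s))) /=; last first.
    by rewrite perm_to_rem // su.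
  rewrite big_cons rest ?rem_uniq ?undup_uniq // => v.
  rewrite mem_rem_uniq ?undup_uniq // inE /= su andbC.
  by have [->|_] := eqVneq v ord_max; rewrite ?sM ?andbT.
have {}mM : m ord0 = ord_max by apply/eqP/negPn.
have sM : ord_max \in s by rewrite -mM codom_f.
have [v uE] : exists v, undup s = ord_max :: rcons v ord0.
  have : sorted (fun x y : 'I_n.+1 => (y <= x)%N) (undup s).
    exact: (subseq_sorted (@geq_ord_trans _) (undup_subseq _) ni).
  rewrite (sorted_pairwise (@geq_ord_trans _)).
  have := su ord0; have := su ord_max; rewrite s0 sM.
  case: (undup s) => // x v.
  move=> xM x0 /= /andP[xv pv].
  have xE : x = ord_max.
    move: xM; rewrite inE => /orP[/eqP ->//|/(allP xv) h].
    by apply/val_inj/anti_leq; rewrite h -ltnS ltn_ord.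
  move: x0; rewrite xE inE (negPf ab) /=.
  case/lastP: v pv {xv xM} => // v y.
  rewrite pairwise_rcons => /andP[yv _] y0; exists v; congr (_ :: rcons _ _).
  move: y0; rewrite mem_rcons inE => /orP[/eqP <-//|/(allP yv) h].
  by apply/val_inj/eqP; rewrite -leqn0.
have uu := undup_uniq s; rewrite uE in uu *.
rewrite map_cons map_rcons /= size_rcons big_add1 /= nth_rcons size_map ltnn eqxx.
rewrite /merged_fact -/s [(count_mem ord0 s + _)%N]addnC; congr (_ * _)%N.
have /andP[Mv /andP[v0 vu]] : [&& ord_max \notin v, ord0 \notin v & uniq v].
  move: uu; rewrite /= mem_rcons inE negb_or rcons_uniq.
  by move=> /andP[/andP[_ ->] /andP[-> ->]].
rewrite -(rest v) // => [|w].
  rewrite -[RHS]prod_nth_fact; apply: eq_big_nat => k /andP[_ kv].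
  by rewrite nth_rcons size_map kv.
rewrite -su uE inE mem_rcons inE.
have [->|w0] := eqVneq w ord0; first by rewrite (negPf v0) /= andbF.
have [->|wM] := eqVneq w ord_max; first by rewrite (negPf Mv) /=.
by rewrite /= andbT.
Qed.

(** * The weighted sum over the alcove as a sum over boxes *)

(** The arrangements counted by lambda, for all points of Lam n together. *)
Definition cell (d n : nat) (m : {ffun 'I_d.+1 -> 'I_n.+1}) : bool :=
  precedes ord0 ord_max (codom m) && (ord0 \in codom m).

(** Sorting maps the arrangements in [cell] onto the alcove, a symmetric F is
    constant on the fibres, and the fibre over m has lambda elements. *)
Lemma sum_lambda_Lam (R : realType) (d n : nat) (F : 'rV[int]_d.+1 -> R[i]) :
  (0 < n)%N -> (forall (s : 'S_d.+1) k, F (col_perm s k) = F k) ->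
  \sum_(k \in Lam d n) lambda R n k * F k = \sum_(m | @cell d n m) F (rowH m).
Proof.
move=> n0 Fs; rewrite fsbig_Lam.
rewrite [RHS](partition_big (@sortH d n) (@alcove d n)) => [/=|m /andP[_ m0]].
  apply: eq_bigr => m' am'; have /andP[ni /eqP m0] := am'.
  have cE (m : {ffun 'I_d.+1 -> 'I_n.+1}) : cell m && (sortH m == m')
      = (precedes ord0 ord_max (codom m)) && perm_eq (codom m) (codom m').
    rewrite sortH_eq // /cell -andbA; congr (_ && _).
    have [pm|] := boolP (perm_eq _ _); rewrite ?andbF // andbT.
    by rewrite (perm_mem pm) -m0 codom_f.
  rewrite (eq_bigl _ _ cE) (eq_bigr (fun _ => F (rowH m'))); last first.
    by move=> m /andP[_ /rowH_perm[s ->]].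
  rewrite sumr_const card_arrangements ?size_codom ?card_ord //.
  rewrite lambda_rowH // -[RHS]mulr_natl; congr (_ * _).
  have ab : (ord0 : 'I_n.+1) != ord_max by rewrite -val_eqE /= eq_sym -lt0n.
  have := count_permutations_precedes (codom m') ab.
  rewrite size_codom card_ord => <-.
  by rewrite natrM mulfK // pnatr_eq0 -lt0n merged_fact_gt0.
rewrite /alcove sortH_noninc /=.
have : ord0 \in codom (sortH m) by rewrite (perm_mem (perm_sortH m)).
move=> /codomP[i i0]; rewrite -val_eqE /= -leqn0.
case: (eqVneq i ord_max) i0 => [->|ne] i0; first by rewrite -i0.
have /noninc_le/(_ i ord_max) := sortH_noninc m.
by rewrite -i0; apply; rewrite ltn_neqAle ne -ltnS ltn_ord.
Qed.

(** The k-th side of the box of arrangements whose last entry 0 is at place i;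
    for e = false the value n is excluded throughout. *)
Definition slab (d n : nat) (e : bool) (i k : 'I_d.+1) : pred 'I_n.+1 :=
  fun x => if (k < i)%N then (x < n)%N
           else if k == i then x == ord0 else (0 < x < n + e)%N.

Lemma cellP (d n : nat) (m : {ffun 'I_d.+1 -> 'I_n.+1}) : (0 < n)%N ->
  reflect (exists2 i : 'I_d.+1, m i = ord0 &
             forall k : 'I_d.+1,
               ((k < i)%N -> (m k < n)%N) /\ ((i < k)%N -> (0 < m k)%N))
          (cell m).
Proof.
move=> n0.
have sz : size (codom m) = d.+1 by rewrite size_codom card_ord.
apply: (iffP andP) => [[/(pairwiseP ord0) nb z]|[i mi h]].
  have /codomP[i0 i0P] := z.
  pose P (i : 'I_d.+1) := m i == ord0.
  have Pi0 : P i0 by rewrite /P -i0P.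
  (* The place i is the last one with entry 0. *)
  case: (arg_maxnP (fun i : 'I_d.+1 => i : nat) Pi0) => i /eqP mi imax.
  exists i => // k; split=> [ki|ik].
    have := nb k i; rewrite !inE !sz !nth_codom_ord mi eqxx andbT.
    move=> /(_ (ltn_ord k) (ltn_ord i) ki).
    by rewrite -val_eqE /= ltn_neqAle -ltnS ltn_ord andbT.
  rewrite lt0n; apply/negP => k0.
  have := imax k; rewrite /P -val_eqE k0 => /(_ isT).
  by move=> ki; have := leq_ltn_trans ki ik; rewrite ltnn.
split; last by rewrite -mi codom_f.
apply/(pairwiseP ord0) => p q; rewrite !inE !sz => pd qd pq.
rewrite -[p]/(nat_of_ord (Ordinal pd)) -[q]/(nat_of_ord (Ordinal qd)).
rewrite !nth_codom_ord; apply/negP => /andP[/eqP mp /eqP mq].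
have [pi|ip|pi] := ltngtP p i.
- by have := (h (Ordinal pd)).1 pi; rewrite mp ltnn.
- by have := (h (Ordinal qd)).2 (ltn_trans ip pq); rewrite mq.
- have pE : Ordinal pd = i by apply: val_inj.
  by move: mp; rewrite pE mi => /(congr1 val) /= e; rewrite -e in n0.
Qed.

(** The boxes are disjoint because the last place with entry 0 is unique. *)
Lemma sum_cell_slabs (V : nmodType) (d n : nat) (e : bool)
    (f : {ffun 'I_d.+1 -> 'I_n.+1} -> V) : (0 < n)%N ->
  \sum_(m | cell m && (e || (ord_max \notin codom m))) f m
    = \sum_i \sum_(m in family (@slab d n e i)) f m.
Proof.
move=> n0.
have slabP i (m : {ffun 'I_d.+1 -> 'I_n.+1}) : reflect
    ([/\ m i = ord0,
       forall k : 'I_d.+1,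
         ((k < i)%N -> (m k < n)%N) /\ ((i < k)%N -> (0 < m k)%N) &
       e || (ord_max \notin codom m)]) (m \in family (@slab d n e i)).
  apply: (iffP familyP) => [h|[mi h ne] k].
    have mi : m i = ord0.
      by have : slab e i i (m i) := h i; rewrite /slab ltnn eqxx => /eqP.
    split=> // [k|].
      have H : slab e i k (m k) := h k; rewrite /slab in H.
      split=> [ki|ik]; first by rewrite ki in H.
      by move: H; rewrite ltnNge ltnW //= -val_eqE gtn_eqF //= => /andP[].
    case: e h => //= h; apply/negP => /codomP[k mk].
    have : slab false i k (m k) := h k; rewrite /slab -mk addn0 /= ltnn andbF.
    case: ifP => //; case: eqVneq => // ki _ /eqP.
    by move=> /(congr1 val) /= nz; rewrite nz in n0.
  change (slab e i k (m k)); rewrite /slab; have [k1 k2] := h k.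
  case: ltngtP => ki.
  - exact: k1.
  - rewrite k2 // -val_eqE gtn_eqF //=.
    case: e ne => /= [_|nM]; first by rewrite addn1 ltn_ord.
    rewrite addn0 ltn_neqAle -ltnS ltn_ord andbT.
    apply: contra nM => /eqP mk; apply/codomP; exists k; exact/val_inj.
  - by have -> : k = i by [apply: val_inj]; rewrite eqxx mi.
pose last0 (m : {ffun 'I_d.+1 -> 'I_n.+1}) :=
  odflt ord0 [pick i : 'I_d.+1 | m \in family (@slab d n e i)].
have uniq_i i i' m : m \in family (@slab d n e i) ->
    m \in family (@slab d n e i') -> i = i'.
  move=> /slabP[mi h _] /slabP[mi' h' _]; apply: val_inj.
  case: (ltngtP i i') => // ii.
    by have := (h i').2 ii; rewrite mi'.
  by have := (h' i).2 ii; rewrite mi.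
rewrite (partition_big last0 xpredT) //=; apply: eq_bigr => i _.
apply: eq_bigl => m; apply/andP/idP => [[/andP[/(cellP _ n0)[j mj h] ne]]|mi].
  have mjs : m \in family (@slab d n e j) by apply/slabP.
  rewrite /last0; case: pickP => [j' mj'|/(_ j)]; last by rewrite mjs.
  by move=> /eqP <-.
split.
  by have /slabP[m0 h ->] := mi; rewrite andbT; apply/cellP => //; exists i.
rewrite /last0; case: pickP => [j mj|/(_ i)]; last by rewrite mi.
by rewrite (uniq_i _ _ _ mj mi) eqxx.
Qed.

(** * The kernels *)

(** For u of sum zero the common shift by the sum of the m_j is invisible, so
    the character separates into the coordinates. *)
Lemma phi_rowH (R : realType) (d n : nat) (m : {ffun 'I_d.+1 -> 'I_n.+1})
    (u : 'rV[R]_d.+1) : \sum_i u 0 i = 0 ->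
  phi (rowH m) u = \prod_i cis (2 * pi * ((m i)%:R * u 0 i)).
Proof.
move=> u0; rewrite -cis_sum /phi; congr cis.
have -> : \sum_i (rowH m 0 i)%:~R * u 0 i = d.+1%:R * \sum_i (m i)%:R * u 0 i.
  under eq_bigr do rewrite mxE intrB intrM mulrBl -mulrA.
  by rewrite big_split /= sumrN -!mulr_sumr u0 mulr0 subr0.
by rewrite -[RHS]mulr_sumr mulrA divfK.
Qed.

Lemma phi_mul_conj (R : realType) (d : nat) (k : 'rV[int]_d.+1)
    (t s : 'rV[R]_d.+1) :
  phi k t * conjc (phi k s) = phi k (t - s).
Proof.
rewrite /phi conj_cis -cisD -mulrN -mulrDr -sumrN -big_split /=.
by congr (cis (_ * _)); apply: eq_bigr => i _; rewrite !mxE mulrBr.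
Qed.

Lemma phi_col_perm (R : realType) (d : nat) (s : 'S_d.+1) (k : 'rV[int]_d.+1)
    (t : 'rV[R]_d.+1) :
  phi (col_perm s k) t = phi k (col_perm s^-1 t).
Proof.
rewrite /phi; congr (cis (_ * _)).
rewrite [RHS](reindex_inj (@perm_inj _ s)) /=.
by apply: eq_bigr => i _; rewrite !mxE permK.
Qed.

(** The generalized sine (b = true) and cosine (b = false) at once. *)
Definition TCS (R : realType) (b : bool) (d : nat) (k : 'rV[int]_d.+1)
    (t : 'rV[R]_d.+1) : R[i] :=
  (d.+1)`!%:R^-1 * \sum_(s : 'S_d.+1) (-1) ^+ (b && s) * phi k (col_perm s t).

Lemma TCS_TC (R : realType) (d : nat) (k : 'rV[int]_d.+1) (t : 'rV[R]_d.+1) :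
  TCS false k t = TC k t.
Proof. by rewrite /TCS /TC; under eq_bigr do rewrite mul1r. Qed.

Lemma TCS_TS (R : realType) (d : nat) (k : 'rV[int]_d.+1) (t : 'rV[R]_d.+1) :
  TCS true k t = TS k t.
Proof. by []. Qed.

Lemma TCS_col_perm (R : realType) (b : bool) (d : nat) (s : 'S_d.+1)
    (k : 'rV[int]_d.+1) (t : 'rV[R]_d.+1) :
  TCS b (col_perm s k) t = (-1) ^+ (b && s) * TCS b k t.
Proof.
rewrite /TCS mulrCA; congr (_ * _); rewrite mulr_sumr.
rewrite (reindex_inj (mulgI s)) /=; apply: eq_bigr => p _.
rewrite phi_col_perm -col_permM mulKg mulrA -signr_addb odd_permM.
by congr ((-1) ^+ _ * _); case: b; case: odd_perm.
Qed.

Lemma TCS_product_sym (R : realType) (b : bool) (d : nat) (s : 'S_d.+1)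
    (k : 'rV[int]_d.+1) (t t' : 'rV[R]_d.+1) :
  TCS b (col_perm s k) t * conjc (TCS b (col_perm s k) t')
    = TCS b k t * conjc (TCS b k t').
Proof.
rewrite !TCS_col_perm; case: (b && s); rewrite ?expr1 ?expr0 ?mul1r //.
by rewrite !mulN1r (rmorphN (@conjc R)) mulrNN.
Qed.

(** Exchanging the two equal entries of k fixes k and changes the sign of
    TS_k. *)
Lemma TS_eq0 (R : realType) (d : nat) (k : 'rV[int]_d.+1) (t : 'rV[R]_d.+1)
    (i j : 'I_d.+1) : i != j -> k 0 i = k 0 j -> TS k t = 0.
Proof.
move=> ij kij; have := TCS_col_perm true (tperm i j) k t.
have -> : col_perm (tperm i j) k = k.
  by apply/rowP => l; rewrite mxE; case: tpermP => [->|->|].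
rewrite odd_tperm ij expr1 mulN1r !TCS_TS => /eqP.
by rewrite -addr_eq0 -mulr2n mulrn_eq0 => /eqP.
Qed.

Lemma normc_sign (R : realType) (b : bool) : normc ((-1) ^+ b : R[i]) = 1 :> R.
Proof. by case: b; rewrite ?expr1 ?normc_opp ?expr0 normc1. Qed.

(** Over a box the sum of products is the product of the sums over the sides;
    the degenerate side i contributes 1 and every other one is a geometric sum
    of at most n terms. *)
Lemma slab_exp_sum_le (R : realType) (d n : nat) (e : bool) (i : 'I_d.+1)
    (u : 'I_d.+1 -> R) : (0 < n)%N ->
  normc (\sum_(m in family (@slab d n e i))
           \prod_k cis (2 * pi * ((m k)%:R * u k)))
    <= \prod_k (if k == i then 1 else peak n (u k)).
Proof.
move=> n0.
rewrite -(bigA_distr_big_dep _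
  (fun k (x : 'I_n.+1) => cis (2 * pi * ((x : nat)%:R * u k)))).
rewrite normc_prod; apply: ler_prod => k _; rewrite normc_ge0 /=.
have interval (a c : nat) : (a <= c <= n.+1)%N ->
    \sum_(x < n.+1 | (a <= x < c)%N) cis (2 * pi * (x%:R * u k))
    = \sum_(a <= x < c) cis (2 * pi * (x%:R * u k)).
  move=> /andP[ac cn].
  rewrite -(big_mkord (fun x => a <= x < c)%N (fun x => cis (2 * pi * (x%:R * u k)))).
  rewrite [RHS](big_nat_widen _ _ n.+1) // [RHS](big_nat_widenl _ 0) //.
  by apply: eq_bigl => x; rewrite andbC.
rewrite /slab; have [ki|ik] := ltnP k i.
  have -> : (k == i) = false by rewrite -val_eqE ltn_eqF.
  by rewrite (interval 0%N n) ?leqnSn // geometric_le_peak // subn0.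
case: eqP => [_|_].
  by rewrite big_pred1_eq mul0r mulr0 cis0 normc1 lexx.
apply: le_trans (_ : normc (\sum_(1 <= x < n + e)
    cis (2 * pi * (x%:R * u k))) <= _).
  by rewrite -interval //; case: e; rewrite ?addn1 ?addn0 ?n0 ?leqnSn /=.
by apply: geometric_le_peak; case: e; rewrite ?addn1 ?addn0 ?subn1 ?leq_pred.
Qed.

(** The bound for the sum over the i-th box, at t permuted by s minus v
    permuted by p. *)
Definition peaks (R : realType) (d n : nat) (i : 'I_d.+1) (s p : 'S_d.+1)
    (t v : 'rV[R]_d.+1) : R :=
  \prod_k (if k == i then 1 else peak n (t 0 (s k) - v 0 (p k))).

Definition cell_kernel (R : realType) (b e : bool) (d n : nat)
    (t v : 'rV[R]_d.+1) : R[i] :=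
  \sum_(m | @cell d n m && (e || (ord_max \notin codom m)))
    TCS b (rowH m) t * conjc (TCS b (rowH m) v).

(** Expanding both orbit sums leaves, for each pair of permutations, a sum of
    single characters over the boxes; only the triangle inequality is used
    between different pairs and different boxes, the cancellation inside a box
    being enough. *)
Lemma normc_cell_kernel_le (R : realType) (b e : bool) (d n : nat)
    (t v : 'rV[R]_d.+1) :
  (0 < n)%N -> \sum_i t 0 i = 0 -> \sum_i v 0 i = 0 ->
  normc (cell_kernel b e n t v)
    <= ((d.+1)`!%:R ^+ 2)^-1 * \sum_s \sum_p \sum_i peaks n i s p t v.
Proof.
move=> n0 t0 v0.
have expand (m : {ffun 'I_d.+1 -> 'I_n.+1}) :
    TCS b (rowH m) t * conjc (TCS b (rowH m) v)
    = ((d.+1)`!%:R ^+ 2)^-1 * \sum_(s : 'S_d.+1) \sum_(p : 'S_d.+1)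
        (-1) ^+ (b && s) * (-1) ^+ (b && p)
         * \prod_k cis (2 * pi * ((m k)%:R * (t 0 (s k) - v 0 (p k)))).
  rewrite /TCS (rmorphM (@conjc R)) fmorphV rmorph_nat mulrACA -invfM -expr2.
  congr (_ * _); rewrite rmorph_sum mulr_suml; apply: eq_bigr => s _.
  rewrite mulr_sumr; apply: eq_bigr => p _.
  rewrite (rmorphM (@conjc R)) rmorph_sign mulrACA phi_mul_conj; congr (_ * _).
  have perm0 (q : 'S_d.+1) (w : 'rV[R]_d.+1) :
      \sum_i w 0 i = 0 -> \sum_i (col_perm q w) 0 i = 0.
    move=> w0; under eq_bigr do rewrite mxE.
    by rewrite -[RHS]w0 [RHS](reindex_inj (@perm_inj _ q)).
  rewrite phi_rowH; first by apply: eq_bigr => k _; rewrite !mxE.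
  under eq_bigr do rewrite mxE [X in _ + X]mxE.
  by rewrite sumrB !perm0 // subrr.
rewrite /cell_kernel; under eq_bigr do rewrite expand.
rewrite -mulr_sumr normcM.
have -> : normc ((d.+1)`!%:R ^+ 2)^-1 = ((d.+1)`!%:R ^+ 2)^-1 :> R.
  by rewrite normcV expr2 normcM normc_nat -expr2.
rewrite ler_wpM2l ?invr_ge0 ?exprn_ge0 //.
rewrite exchange_big; apply: le_trans (normc_sum _ _ _) _.
apply: ler_sum => s _.
rewrite exchange_big; apply: le_trans (normc_sum _ _ _) _.
apply: ler_sum => p _.
rewrite -mulr_sumr !normcM !normc_sign !mul1r sum_cell_slabs //.
apply: le_trans (normc_sum _ _ _) _.
by apply: ler_sum => i _; exact: slab_exp_sum_le.
Qed.

(** * Summation over the nodes *)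

(** A node has coordinate sum zero, so it is determined by its d coordinates
    other than the one at place p i.  Multiplied by N = (d+1) n and shifted by
    N these are integers in [0, 2N], hence they inject the nodes into
    {0, ..., 3N-1}^d; over this product set the sum factorises. *)
Lemma sum_peaks_le (R : realType) (d n : nat) (i : 'I_d.+1) (s p : 'S_d.+1)
    (t : 'rV[R]_d.+1) : (0 < n)%N ->
  \sum_(m | @alcove d n m) peaks n i s p t (node R n (rowH m))
    <= ((24 * d.+1 * n)%N%:R * (1 + ln (d.+1 * n)%N%:R)) ^+ d.
Proof.
move=> n0; set N := (d.+1 * n)%N.
have N0 : (0 < N)%N by rewrite muln_gt0 n0.
have N3 : (0 < 3 * N)%N by rewrite muln_gt0 N0.
pose G (w : {ffun 'I_d -> 'I_(3 * N)}) : R :=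
  \prod_k peak n (- t 0 (s (lift i k)) - 1 + (w k)%:R / N%:R).
pose w (m : {ffun 'I_d.+1 -> 'I_n.+1}) : {ffun 'I_d -> 'I_(3 * N)} :=
  [ffun k => insubd (Ordinal N3) `|(rowH m 0 (p (lift i k)) + N%:Z)%R|%N].
have wE m k : (w m k : nat)%:Z = rowH m 0 (p (lift i k)) + N%:Z.
  rewrite ffunE val_insubd.
  have := rowH_abs_le m (p (lift i k)); rewrite -/N; set x := rowH _ _ _ => xN.
  have -> : (`|(x + N%:Z)%R|%N < 3 * N)%N by lia.
  by lia.
have Gw m : peaks n i s p t (node R n (rowH m)) = G (w m).
  rewrite /peaks (bigD1_ord i) //= eqxx mul1r; apply: eq_bigr => k _.
  rewrite eq_sym (negPf (neq_lift _ _)).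
  rewrite -[RHS]peakN; congr (peak n _).
  have -> : (w m k)%:R = (rowH m 0 (p (lift i k)))%:~R + N%:R :> R.
    by rewrite -[LHS]/(((w m k : nat)%:Z)%:~R) wE intrD.
  rewrite !mxE -/N; field; by rewrite pnatr_eq0 -lt0n.
have winj : {in [set m | @alcove d n m] &, injective w}%SET.
  move=> m m'; rewrite !inE => am am' ww.
  apply: (rowH_inj am am'); apply/rowP.
  have el (k : 'I_d) : rowH m 0 (p (lift i k)) = rowH m' 0 (p (lift i k)).
    by apply: (addIr N%:Z); rewrite -!wE ww.
  have sp (m1 : {ffun 'I_d.+1 -> 'I_n.+1}) : \sum_k rowH m1 0 (p k) = 0.
    by rewrite -[RHS](sum_rowH m1) [RHS](reindex_inj (@perm_inj _ p)).
  have := etrans (sp m) (esym (sp m')).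
  rewrite [LHS](bigD1_ord i) // [RHS](bigD1_ord i) //=.
  under eq_bigr do rewrite el.
  move=> /addIr ei l; rewrite -[l](permKV p).
  by have [k ->|->] := unliftP i (p^-1%g l).
rewrite (eq_bigr (fun m => G (w m))) => [|m _]; last exact: Gw.
have G0 v : 0 <= G v by apply: prodr_ge0 => k _; exact: peak_ge0.
apply: le_trans (_ : \sum_v G v <= _).
  have -> : \sum_(m | @alcove d n m) G (w m)
      = \sum_(m in [set m | @alcove d n m]%SET) G (w m).
    by apply: eq_bigl => m; rewrite inE.
  rewrite -(big_imset G winj) /=.
  rewrite [leRHS](bigID (mem (w @: [set m | @alcove d n m]%SET))) /=.
  by rewrite lerDl sumr_ge0.
rewrite /G -(bigA_distr_bigA
  (fun k (x : 'I_(3 * N)) => peak n (- t 0 (s (lift i k)) - 1 + (x : nat)%:R / N%:R))).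
rewrite -[X in _ ^+ X]card_ord -prodr_const.
apply: ler_prod => k _; rewrite sumr_ge0 /= => [|x _]; last exact: peak_ge0.
(* Three periods cover the values 0, ..., 2N; the constant is 24 = 8 * 3. *)
have := @peak_sum_le R n d.+1 3 N (- t 0 (s (lift i k)) - 1) n0 isT erefl.
by rewrite -[(8 * 3 * _ * n)%N]/(24 * d.+1 * n)%N.
Qed.

(** * The interpolation kernels at the nodes *)

Lemma node_simplexH (R : realType) (d n : nat) (j : 'rV[int]_d.+1) :
  (0 < n)%N -> Lam d n j -> simplexH R d (node R n j).
Proof.
move=> n0 [[j0 _] jle jtop].
have N0 : 0 < (d.+1 * n)%N%:R :> R by rewrite ltr0n muln_gt0.
have nodeE i : node R n j 0 i = (j 0 i)%:~R / (d.+1 * n)%N%:R.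
  by rewrite !mxE mulrC.
split=> [|i k ik].
  by under eq_bigr do rewrite nodeE; rewrite -mulr_suml -rmorph_sum /= j0 mul0r.
rewrite !nodeE -mulrBl -intrB divr_ge0 ?ler0z ?subr_ge0 ?jle ?(ltW N0) //=.
rewrite ler_pdivrMr // mul1r -[leRHS]/(((d.+1 * n)%N%:Z)%:~R) ler_int.
rewrite lerBlDl; apply: le_trans (le_trans jtop _).
  by have [->//|i0] := eqVneq i ord0; apply: jle; rewrite lt0n.
rewrite lerD2r; have [->//|kd] := eqVneq k ord_max; apply: jle.
by rewrite ltn_neqAle kd -ltnS ltn_ord.
Qed.

Lemma Lam_int_sub (d n : nat) : Lam_int d n `<=` Lam d n.
Proof. by move=> k [kH dec /ltW top]; split=> // i j /dec/ltW. Qed.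

Lemma lambda_Lam_int (R : realType) (d n : nat) (k : 'rV[int]_d.+1) :
  Lam_int d n k -> lambda R n k = (d.+1)`!%:R.
Proof.
move=> [_ dec top]; rewrite /lambda top.
have kI : injective (fun i => k 0 i).
  move=> i j kij; apply: val_inj; case: (ltngtP i j) => // /dec.
    by rewrite kij ltxx.
  by rewrite kij ltxx.
have su : uniq [seq k 0 i | i <- enum 'I_d.+1] by rewrite map_inj_uniq ?enum_uniq.
have ss : size [seq k 0 i | i <- enum 'I_d.+1] = d.+1.
  by rewrite size_map size_enum_ord.
have mE : mults k = nseq d.+1 1%N.
  rewrite /mults undup_id //; apply: (@eq_from_nth _ 0%N).
    by rewrite size_map ss size_nseq.
  move=> i; rewrite size_map ss => id.
  rewrite nth_nseq id (nth_map 0) ?ss //.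
  by rewrite count_uniq_mem // mem_nth // ss.
rewrite mE size_nseq big_nat big1 ?divr1 // => i /andP[_ id].
by rewrite nth_nseq id.
Qed.

Lemma cosine_kernel (R : realType) (d n : nat) (t v : 'rV[R]_d.+1) :
  (0 < n)%N ->
  \sum_(k \in Lam d n) (lambda R n k * TC k t * conjc (TC k v))
    = cell_kernel false true n t v.
Proof.
move=> n0; rewrite /cell_kernel; under [RHS]eq_bigl do rewrite andbT.
rewrite -(@sum_lambda_Lam R d n (fun k => TCS false k t * conjc (TCS false k v))) //.
  by apply: eq_fsbigr => k _; rewrite !TCS_TC mulrA.
by move=> s k; exact: TCS_product_sym.
Qed.

(** The sine products are symmetric in k, and [thin] cuts out of Lam n the
    points whose arrangements avoid the value n.  Among these the points
    outside Lam_int have a repeated entry, where TS vanishes, and the points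
    of Lam_int have weight (d+1)!. *)
Lemma sine_kernel (R : realType) (d n : nat) (t v : 'rV[R]_d.+1) :
  (0 < n)%N ->
  (d.+1)`!%:R * \sum_(k \in Lam_int d n) (TS k t * conjc (TS k v))
    = cell_kernel true false n t v.
Proof.
move=> n0.
pose thin (k : 'rV[int]_d.+1) :=
  [forall i, forall j, k 0 i < k 0 j + (d.+1 * n)%N%:Z].
pose F k := if thin k then TCS true k t * conjc (TCS true k v) else 0.
have Fs (s : 'S_d.+1) k : F (col_perm s k) = F k.
  rewrite /F TCS_product_sym; congr (if _ then _ else _).
  apply/forallP/forallP => h i; apply/forallP => j.
    by have /forallP := h (s^-1%g i) => /(_ (s^-1%g j)); rewrite !mxE !permKV.
  by have /forallP := h (s i) => /(_ (s j)); rewrite !mxE.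
have thin_int k : Lam_int d n k -> thin k.
  move=> [_ dec top]; apply/forallP => i; apply/forallP => j.
  have i0 : k 0 i <= k 0 ord0.
    by have [->//|i0] := eqVneq i ord0; apply/ltW/dec; rewrite lt0n.
  have jd : k 0 ord_max <= k 0 j.
    have [->//|jd] := eqVneq j ord_max; apply/ltW/dec.
    by rewrite ltn_neqAle jd -ltnS ltn_ord.
  by apply: le_lt_trans i0 (lt_le_trans top _); rewrite lerD2r.
rewrite mulr_fsumr.
transitivity (\sum_(k \in Lam d n) lambda R n k * F k).
  rewrite -[RHS](fsbig_widen (Lam_int d n)) => [|k /Lam_int_sub//|k [kL kI]].
    apply: eq_fsbigr => k /set_mem kI.
    by rewrite lambda_Lam_int // /F thin_int.
  rewrite /= /F; case: ifP => tk; last by rewrite mulr0.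
  have [kH kle ktop] := kL.
  have [i [j [ij kij]]] : exists i j : 'I_d.+1, i != j /\ k 0 i = k 0 j.
    apply: contrapT => ne; apply: kI; split=> // [i j ij|].
      rewrite lt_neqAle kle // andbT; apply/eqP => kij; apply: ne.
      by exists i, j; split; [rewrite -val_eqE ltn_eqF|].
    by have /forallP/(_ ord0)/forallP := tk; apply.
  by rewrite !TCS_TS (TS_eq0 _ ij kij) mul0r mulr0.
rewrite sum_lambda_Lam //.
rewrite big_mkcond [RHS]big_mkcond /=; apply: eq_bigr => m _.
have [mc|//] := boolP (cell m); rewrite /F /=.
have thinE : thin (rowH m) = (ord_max \notin codom m).
  have eq_lt i j : (rowH m 0 i < rowH m 0 j + (d.+1 * n)%N%:Z) = (m i < m j + n)%N.
    rewrite addrC -ltrBlDr rowH_sub PoszM ltr_pM2l // ltrBlDr -PoszD ltz_nat.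
    by rewrite addnC.
  apply/forallP/idP => [h|nM i].
    apply/negP => /codomP[i mi]; have /andP[_ /codomP[j mj]] := mc.
    by have /forallP/(_ j) := h i; rewrite eq_lt -mi -mj /= ltnn.
  apply/forallP => j; rewrite eq_lt ltn_addl // ltn_neqAle -ltnS ltn_ord andbT.
  apply: contra nM => /eqP mi; apply/codomP; exists i; exact/val_inj.
by rewrite thinE.
Qed.

Lemma sum_kernel_le (R : realType) (b e : bool) (d n : nat) (t : 'rV[R]_d.+1) :
  (0 < n)%N -> \sum_i t 0 i = 0 ->
  \sum_(j | @alcove d n j)
    normc (cell_kernel b e n t (node R n (rowH j)))
  <= d.+1%:R * ((24 * d.+1 * n)%N%:R * (1 + ln (d.+1 * n)%N%:R)) ^+ d.
Proof.
move=> n0 t0; set B := _ ^+ d.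
have F0 : 0 < (d.+1)`!%:R :> R by rewrite ltr0n fact_gt0.
apply: le_trans (_ : \sum_(j | @alcove d n j) ((d.+1)`!%:R ^+ 2)^-1 *
    \sum_s \sum_p \sum_i peaks n i s p t (node R n (rowH j)) <= _).
  apply: ler_sum => j aj; apply: normc_cell_kernel_le => //.
  have jL : Lam d n (rowH j) by rewrite Lam_rowH; exists j.
  by have [] := node_simplexH R n0 jL.
rewrite -mulr_sumr ler_pdivrMl ?exprn_gt0 //.
rewrite exchange_big.
apply: le_trans (_ : \sum_(s : 'S_d.+1) \sum_(p : 'S_d.+1) \sum_(i < d.+1) B <= _).
  apply: ler_sum => s _; rewrite exchange_big; apply: ler_sum => p _.
  by rewrite exchange_big; apply: ler_sum => i _; exact: sum_peaks_le.
have -> : \sum_(s : 'S_d.+1) \sum_(p : 'S_d.+1) \sum_(i < d.+1) B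
    = B * d.+1%:R * (d.+1)`!%:R * (d.+1)`!%:R.
  by rewrite !sumr_const card_ord !card_Sn !mulr_natr.
move: (d.+1)`!%:R d.+1%:R B {F0} => x y z.
by rewrite le_eqVlt; apply/orP; left; apply/eqP; ring.
Qed.

(** * Operator norms *)

Lemma op_norm_le (R : realType) (T : topologicalType) (X : set T)
    (L : (T -> R[i]) -> (T -> R[i])) (c : R) :
  (forall f t, (forall x, X x -> normc (f x) <= 1) -> X t ->
     normc (L f t) <= c) ->
  (op_norm X L <= c%:E)%E.
Proof.
move=> Lc; apply: ge_ereal_sup => _ [f [_ f1] <-].
apply: ge_ereal_sup => _ [t Xt <-]; rewrite lee_fin; apply: Lc => // x Xx.
rewrite -lee_fin; apply: le_trans f1.
by apply: ereal_sup_ubound; exists x.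
Qed.

Definition lebesgue_bound (R : realType) (d : nat) : R :=
  (d.+1)`!%:R * (24 * d.+1%:R * ((1 + ln d.+1%:R) / ln 2 + 1)) ^+ d.

(** The sum over the nodes is of order (n (1 + log ((d+1) n)))^d, and the
    quadrature weights are of order n^(-d).  As n >= 2, the terms
    1 + log (d+1) are absorbed into log n by comparing with log 2. *)
Lemma weighted_kernel_le (R : realType) (b e : bool) (d n : nat)
    (t : 'rV[R]_d.+1) (w : {ffun 'I_d.+1 -> 'I_n.+1} -> R[i]) :
  (1 < n)%N -> \sum_i t 0 i = 0 ->
  (forall j, alcove j -> normc (w j) <= d`!%:R / n%:R ^+ d) ->
  normc (\sum_(j | @alcove d n j)
           w j * cell_kernel b e n t (node R n (rowH j)))
  <= lebesgue_bound R d * ln n%:R ^+ d.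
Proof.
move=> n1 t0 wle; have n0 := ltnW n1.
have nR : 0 < n%:R :> R by rewrite ltr0n.
apply: le_trans (normc_sum _ _ _) _.
apply: le_trans (_ : d`!%:R / n%:R ^+ d * (d.+1%:R *
    ((24 * d.+1 * n)%N%:R * (1 + ln (d.+1 * n)%N%:R)) ^+ d) <= _).
  apply: le_trans (ler_wpM2l _ (sum_kernel_le b e n0 t0)).
    rewrite mulr_sumr; apply: ler_sum => j aj.
    by rewrite normcM ler_wpM2r ?normc_ge0 // wle.
  by rewrite divr_ge0 // exprn_ge0.
have l2 : 0 < ln 2 :> R by rewrite ln_gt0 // ltr1n.
have ln2 : ln 2 <= ln n%:R :> R by rewrite ler_ln ?posrE ?ltr0n // ler_nat.
have ld : 0 <= ln d.+1%:R :> R by rewrite ln_ge0 // ler1n.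
have lnN : 1 + ln (d.+1 * n)%N%:R
    <= ((1 + ln d.+1%:R) / ln 2 + 1) * ln n%:R :> R.
  rewrite natrM lnM ?posrE ?ltr0n // addrA mulrDl mul1r lerD2r.
  rewrite -[leLHS](divfK (lt0r_neq0 l2)) ler_wpM2l // divr_ge0 ?(ltW l2) //.
  by rewrite addr_ge0.
have lnN0 : 0 <= 1 + ln (d.+1 * n)%N%:R :> R.
  by rewrite addr_ge0 // ln_ge0 // ler1n muln_gt0 n0.
rewrite /lebesgue_bound; set A := _ / _ + 1 in lnN *.
have step : ((24 * d.+1 * n)%N%:R * (1 + ln (d.+1 * n)%N%:R)) ^+ d
    <= n%:R ^+ d * ((24 * d.+1%:R * A) ^+ d * ln n%:R ^+ d) :> R.
  rewrite -!exprMn; apply: lerXn2r; rewrite ?nnegrE ?mulr_ge0 //.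
  - by rewrite addr_ge0 // divr_ge0 ?addr_ge0 // ltW.
  - exact: le_trans (ltW l2) ln2.
  have -> : n%:R * (24 * d.+1%:R * A * ln n%:R)
      = (24 * d.+1 * n)%N%:R * (A * ln n%:R) by rewrite !natrM; ring.
  by rewrite ler_wpM2l.
apply: le_trans (_ : d`!%:R / n%:R ^+ d * (d.+1%:R *
    (n%:R ^+ d * ((24 * d.+1%:R * A) ^+ d * ln n%:R ^+ d))) <= _).
  by rewrite !ler_wpM2l // divr_ge0 // exprn_ge0.
have nd : n%:R ^+ d != 0 :> R by rewrite expf_neq0 // gt_eqF.
rewrite factS natrM.
move: (n%:R ^+ d) nd (d.+1%:R) (d`!%:R) (ln n%:R ^+ d) => x x0 y z l.
by rewrite le_eqVlt; apply/orP; left; apply/eqP; field.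
Qed.

Lemma interp_star_norm_le (R : realType) (d n : nat)
    (f : 'rV[R]_d.+1 -> R[i]) (t : 'rV[R]_d.+1) :
  (1 < n)%N -> (forall x, simplexH R d x -> normc (f x) <= 1) ->
  simplexH R d t ->
  normc (interp_star R d n f t) <= lebesgue_bound R d * ln n%:R ^+ d.
Proof.
move=> n1 f1 [t0 _]; have n0 := ltnW n1.
rewrite /interp_star fsbig_Lam.
under eq_bigr do rewrite cosine_kernel //.
apply: (@weighted_kernel_le _ false true _ _ _ (fun j => f (node R n (rowH j))
  * (lambda R n (rowH j) / (d.+1%:R * n%:R ^+ d)))) => // j aj.
have jL : Lam d n (rowH j) by rewrite Lam_rowH; exists j.
rewrite lambda_rowH // -natrX -natrM !normcM !normcV !normc_nat natrM natrX.
apply: le_trans (_ : 1 * ((d.+1)`!%:R / 1 / (d.+1%:R * n%:R ^+ d)) <= _).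
  apply: ler_pM.
  - exact: normc_ge0.
  - by rewrite !divr_ge0 ?mulr_ge0 ?exprn_ge0.
  - by apply: f1; exact: node_simplexH.
  - rewrite ler_wpM2r ?invr_ge0 ?mulr_ge0 ?exprn_ge0 // ler_wpM2l //.
    by rewrite lef_pV2 ?posrE ?ltr0n ?merged_fact_gt0 // ler1n merged_fact_gt0.
by rewrite mul1r divr1 factS natrM -mulf_div divff ?mul1r.
Qed.

Lemma interp_norm_le (R : realType) (d n : nat)
    (f : 'rV[R]_d.+1 -> R[i]) (t : 'rV[R]_d.+1) :
  (1 < n)%N -> (forall x, simplexH R d x -> normc (f x) <= 1) ->
  simplexH R d t ->
  normc (interp R d n f t) <= lebesgue_bound R d * ln n%:R ^+ d.
Proof.
move=> n1 f1 [t0 _]; have n0 := ltnW n1.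
rewrite /interp -{1}(setIidr (@Lam_int_sub d n)).
rewrite fsbig_mkcondr fsbig_Lam.
rewrite (eq_bigr (fun j => (if rowH j \in Lam_int d n then
    f (node R n (rowH j)) * (d`!%:R / n%:R ^+ d) else 0)
    * cell_kernel true false n t (node R n (rowH j)))); last first.
  move=> j _; case: ifP => _; last by rewrite mul0r.
  rewrite -sine_kernel // natrM; move: (\sum_(k \in _) _) => S.
  ring.
apply: weighted_kernel_le => // j aj; case: ifP => _; last first.
  by rewrite normc0 divr_ge0 // exprn_ge0.
have jL : Lam d n (rowH j) by rewrite Lam_rowH; exists j.
rewrite -natrX !normcM !normcV !normc_nat natrX.
rewrite ler_piMl ?divr_ge0 ?exprn_ge0 // f1 //.
exact: node_simplexH.
Qed.

Theorem theorem4p8 (R : realType) (d : nat) (hd : (1 <= d)%N) :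
  exists c : R, forall n : nat, (2 <= n)%N ->
    (op_norm (simplexH R d) (interp R d n) <= (c * ln n%:R ^+ d)%:E)%E /\
    (op_norm (simplexH R d) (interp_star R d n) <= (c * ln n%:R ^+ d)%:E)%E.
Proof.
exists (lebesgue_bound R d) => n n1.
by split; apply: op_norm_le => f t f1 tX;
  [exact: interp_norm_le | exact: interp_star_norm_le].
Qed.
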